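(* Let $\mathcal{D}$ be a (possibly infinite) strong digraph. Then the infimum of $1-\lambda_S(\mathcal{F})$ taken over all finite (strong) subdigraphs $\mathcal{F}$ of $\mathcal{D}$ is positive on $\mathcal{S}_{<}(\mathcal{D})$ if and only if $\mathcal{D}$ admits a finite cycle transversal and the lengths of all cycles of $\mathcal{D}$ are uniformly bounded above: $$\inf_{\mathcal{F}\subseteq\mathcal{D}}\ \bigl(1-\lambda_S(\mathcal{F})\bigr)>0\quad \forall\, S\in\mathcal{S}_{<}(\mathcal{D})\iff |sct(\mathcal{D})|<\infty\ \text{ and }\ \ell_{max}(\mathcal{D})<\infty.$$
   Context: Digraphs may be infinite, may have loops, but have no multiple arcs. A digraph is strong (strongly connected) if for any pair of distinct vertices $v,w$ there is a path from $v$ to $w$; each vertex of a strong digraph has at least one arc leaving it. A directed cycle is a finite strong digraph in which exactly one arc leaves each vertex (a loop is a cycle of length 1, an undirected edge, i.e. a pair of opposite arcs, is a cycle of length 2); ''cycle'' always means directed cycle, and its length is its number of arcs. $\ell_{max}(\mathcal{D})$ is the length of a longest cycle of $\mathcal{D}$, with $\ell_{max}(\mathcal{D})=\infty$ if cycle lengths are unbounded. Subdigraphs are not necessarily induced, and $\mathcal{F}\subseteq\mathcal{D}$ allows $\mathcal{F}=\mathcal{D}$ when $\mathcal{D}$ is finite. A cycle transversal of $\mathcal{D}$ is a set of vertices whose removal (together with all incident arcs) leaves a digraph with no cycles; $|sct(\mathcal{D})|$ is the size of a smallest cycle transversal, and $|sct(\mathcal{D})|=\infty$ if there is no finite one. A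 weighting of $\mathcal{D}$ is a positive function on its arcs. It is substochastic if for each vertex the sum of the weights of the arcs leaving it (its out-weight) is not greater than $1$, and truthly substochastic if moreover at least one vertex has out-weight strictly less than $1$. $\mathcal{S}_{<}(\mathcal{D})$ is the class of all truthly substochastic weightings of $\mathcal{D}$. For a finite subdigraph $\mathcal{F}$ of $\mathcal{D}$ weighted by $S$, $\lambda_S(\mathcal{F})$ is the Perron root (spectral radius) of its weighted adjacency matrix, whose $(v,w)$ entry is the weight of $(v,w)$ if $(v,w)$ is an arc of $\mathcal{F}$ and $0$ otherwise.
   Formalization: The digraph is assumed to have countably many vertices: an uncountable strong digraph has no substochastic weighting, so the left side holds vacuously, while e.g. the complete digraph on an uncountable set has no finite cycle transversal. *)

(* Defs.v *)
From mathcomp Require Import all_boot all_order all_algebra finmap.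
From mathcomp Require Import boolp classical_sets reals ereal esum.
From mathcomp Require Import complex.

Set Implicit Arguments.
Unset Strict Implicit.
Unset Printing Implicit Defensive.

Import Order.TTheory GRing.Theory Num.Theory.
Local Open Scope classical_set_scope.
Local Open Scope ring_scope.

(* A digraph is a type V of vertices with an arc relation G : rel V: infinite
   vertex sets and loops are allowed, multiple arcs are not.
   V is taken in countType. A strong digraph with a substochastic weighting is
   necessarily countable, since positive weights with finite sum force
   countable out-degrees; on an uncountable strong digraph there is no
   substochastic weighting at all, and a condition quantified over these
   weightings is void. *)

(* The digraph with vertex set A and arc relation G is strong. The second
   clause only matters for a single vertex, which must carry a loop. *)
Definition strong (V : countType) (A : set V) (G : rel V) : Prop :=
  (forall v w, A v -> A w -> v != w -> exists2 p, path G v p & last v p = w) /\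
  (forall v, A v -> exists w, G v w).

(* A directed cycle, given by the sequence of its vertices in cyclic order,
   up to rotation; its length (number of arcs) is size c, and [:: v] is a
   loop at v. *)
Definition dicycle (V : countType) (G : rel V) (c : seq V) : Prop :=
  c <> [::] /\ ucycle G c.

Definition lmax (R : realType) (V : countType) (G : rel V) : \bar R :=
  ereal_sup [set ((size c)%:R%:E : \bar R) | c in [set c | dicycle G c]].

Definition remove_vertices (V : countType) (G : rel V) (T : {fset V}) : rel V :=
  [rel x y | [&& x \notin T, y \notin T & G x y]].

Definition cycle_transversal (V : countType) (G : rel V) (T : {fset V}) : Prop :=
  forall c, ~ dicycle (remove_vertices G T) c.

(* Only finite transversals are considered; if there is none, the infimum
   is +oo. *)
Definition sct_size (R : realType) (V : countType) (G : rel V) : \bar R :=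
  ereal_inf [set ((#|` T|)%:R%:E : \bar R) |
             T in [set T : {fset V} | cycle_transversal G T]].

(* A weighting is represented by a total function S; its values off the arcs
   of G are irrelevant throughout. *)
Definition weighting (R : realType) (V : countType) (G : rel V)
    (S : V -> V -> R) : Prop :=
  forall v w, G v w -> 0 < S v w.

Definition out_weight (R : realType) (V : countType) (G : rel V)
    (S : V -> V -> R) (v : V) : \bar R :=
  (\esum_(w in [set w | G v w]) (S v w)%:E)%E.

Definition substochastic (R : realType) (V : countType) (G : rel V)
    (S : V -> V -> R) : Prop :=
  weighting G S /\ forall v, (out_weight G S v <= 1)%E.

Definition truthly_substochastic (R : realType) (V : countType) (G : rel V)
    (S : V -> V -> R) : Prop :=
  substochastic G S /\ exists v, (out_weight G S v < 1)%E.

(* Finite nonempty subdigraphs of G, not necessarily induced. *)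
Record fsubdigraph (V : countType) (G : rel V) := FSubdigraph {
  fverts : {fset V};
  farcs : V -> V -> bool;
  fverts_neq0 : fverts != fset0;
  farcs_sub : forall v w,
    farcs v w -> [/\ v \in fverts, w \in fverts & G v w]
}.

Definition fstrong (V : countType) (G : rel V) (F : fsubdigraph G) : Prop :=
  strong [set v | v \in fverts F] (farcs F).

Definition wadj (R : realType) (V : countType) (G : rel V) (S : V -> V -> R)
    (F : fsubdigraph G) : 'M[R]_(#|{: fverts F}|) :=
  \matrix_(i, j)
    let v := val (enum_val i) in let w := val (enum_val j) in
    if farcs F v w then S v w else 0.

(* The supremum is over a finite set, nonempty for n > 0, hence a maximum. *)
Definition spectral_radius (R : realType) (n : nat) (A : 'M[R]_n) : R :=
  sup [set ComplexField.Normc.normc z |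
       z in [set z : R[i] | eigenvalue (map_mx (fun x => x%:C%C) A) z]].

Definition perron_root (R : realType) (V : countType) (G : rel V)
    (S : V -> V -> R) (F : fsubdigraph G) : R :=
  spectral_radius (wadj S F).

(* Main.v *)
(* Sufficiency. Let T be a finite transversal and L a bound on the cycle
   lengths. A path avoiding T closes up, by strength, to a closed walk with at
   most |T| visits to T; it splits into cycles, each of length at most L and
   each meeting T, so the path has length at most L |T|. Hence a walk soon
   visits T (or dies), and from each of the finitely many vertices of T it dies
   with positive probability along a fixed path to a deficient vertex. So for
   some n and e > 0 independent of F, all row sums of the n-th power of the
   adjacency matrix of F are at most 1 - e.

   Necessity. If one of the two conditions fails, then for every finite vertex
   set M and every N there is a cycle C with N |C :&: M| <= |C|: disjoint from
   M if there is no finite transversal, very long if lengths are unbounded.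
   Choose cycles C_k one after the other, M being the set of vertices used
   before. A vertex gives almost all its weight to the first C_k through it and
   shares the rest among its other arcs, by an amount depending only on k for
   the arc used by C_k. With N = N_k large, the few old vertices of C_k do not
   matter and the geometric mean of the weights of C_k, which is its Perron
   root, tends to 1. *)
Require Import Defs.
From mathcomp Require Import all_boot all_order all_algebra finmap.
From mathcomp Require Import boolp classical_sets reals ereal esum.
From mathcomp Require Import complex ring lra zify cardinality fsbigop.

Import Order.TTheory GRing.Theory Num.Theory.
Local Open Scope classical_set_scope.
Local Open Scope ring_scope.

Set Implicit Arguments.
Unset Strict Implicit.

(** * Paths avoiding a finite transversal *)

Lemma not_uniq_split (T : eqType) (s : seq T) :
  ~~ uniq s -> exists x a b c, s = a ++ x :: b ++ x :: c.
Proof.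
elim: s => //= y s IH; rewrite negb_and negbK => /orP[ys|/IH].
  by case/splitPr: ys => b c; exists y, [::], b, c.
by move=> [x [a [b [c ->]]]]; exists x, (y :: a), b, c.
Qed.

Section BoundedPaths.
Variables (V : countType) (G : rel V) (T : {fset V}) (L : nat).
Hypothesis T_transversal : cycle_transversal G T.
Hypothesis dicycle_size : forall c, dicycle G c -> (size c <= L)%N.

(* A closed walk splits into cycles, each of which meets T. *)
Lemma closed_walk_size (c : seq V) :
  cycle G c -> (size c <= L * count (mem T) c)%N.
Proof.
have [n] := ubnP (size c); elim: n c => // n IH c cn cG.
have [cu|/not_uniq_split[x [a [b [d cE]]]]] := boolP (uniq c).
  have [->//|c0] := eqVneq c [::].
  have cD : dicycle G c by split; [exact/eqP|rewrite /ucycle cG].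
  have [|cT] := posnP (count (mem T) c); last first.
    by rewrite (leq_trans (dicycle_size cD))// leq_pmulr.
  move=> /eqP; rewrite -leqn0 leqNgt -has_count => /hasPn cT.
  exfalso; apply: (@T_transversal c); split; first exact/eqP.
  rewrite /ucycle cu andbT; apply: (@sub_in_cycle _ [pred x | x \notin T] G) => //.
    by move=> u v; rewrite !inE => uT vT uv; apply/and3P.
  by apply/allP => u /cT.
(* At the repeated vertex [x] the walk is cut into the shorter closed walks [x :: b] and
   [x :: d ++ a]; lengths and visits to [T] add up. *)
have := cG; rewrite cE cycle_catC /= -catA rcons_cat cat_path /=.
move=> /and3P[bG bx dG].
have/IH : (size (x :: b) < n)%N.
  by move: cn; rewrite cE !size_cat /= size_cat /=; lia.
rewrite /= rcons_path bG bx => /(_ isT) h1.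
have/IH : (size (x :: d ++ a) < n)%N.
  by move: cn; rewrite cE !size_cat /= !size_cat /=; lia.
move=> /(_ dG) /=; move: h1; rewrite !size_cat !count_cat /= !size_cat /=.
rewrite !count_cat /=; move: (x \in T : nat) => xT; lia.
Qed.

Lemma transversal_free_path_size (v : V) (p : seq V) : strong [set: V] G ->
  path (remove_vertices G T) v p -> (size p <= L * #|` T|)%N.
Proof.
move=> [Gs _] pP.
have pG : path G v p.
  by apply: sub_path pP => x y /and3P[].
have pT : count (mem T) p = 0%N.
  apply/eqP; rewrite -leqn0 leqNgt -has_count -all_predC.
  elim: p v pP {pG} => //= y p IH v /andP[/and3P[_ -> _]] /IH; exact.
(* The return path is shortened to a simple one, so it visits each vertex of [T] at most once. *)
have [q qG [qv qT]] : exists2 q, path G (last v p) q &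
    last (last v p) q = v /\ (count (mem T) q <= #|` T|)%N.
  have [->|wv] := eqVneq (last v p) v; first by exists [::].
  have [//|//|q] := Gs (last v p) v _ _ wv; case/shortenP => q' q'G q'u _ q'v.
  exists q' => //; split => //; rewrite -size_filter.
  apply: uniq_leq_size; first by rewrite filter_uniq//; case/andP: q'u.
  by move=> x; rewrite mem_filter => /andP[].
have : cycle G (p ++ q).
  rewrite (cycle_path v).
  suff -> : last v (p ++ q) = v by rewrite cat_path pG.
  by rewrite last_cat.
move/closed_walk_size; rewrite size_cat count_cat pT add0n.
have := leq_mul2l L (count (mem T) q) #|` T|; rewrite qT orbT; lia.
Qed.
End BoundedPaths.

(** * Survival vectors and the Perron root *)

Lemma sum_enum_val (V : countType) (G : rel V) (F : fsubdigraph G)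
    (W : nmodType) (f : V -> W) :
  \sum_(i < #|{: fverts F}|) f (val (enum_val i)) = \sum_(v <- fverts F) f v.
Proof.
rewrite big_seq_fsetE /=.
rewrite [RHS](reindex_onto (@enum_val _ predT) enum_rank) => [|w _]; last first.
  exact: enum_rankK.
by apply: eq_big => // j; rewrite enum_valK eqxx.
Qed.

Section Survival.
Variables (R : realType) (V : countType) (G : rel V) (S : V -> V -> R).

Lemma sum_weight_le_out (v : V) (s : seq V) : uniq s -> {in s, forall w, G v w} ->
  ((\sum_(w <- s) S v w)%:E <= out_weight G S v)%E.
Proof.
move=> us sG; apply: esum_ge; exists [set` s].
  by split; [exact: finite_seq|move=> w /sG].
by rewrite -fsbig_seq// sumEFin.
Qed.

Definition arc_weight (F : fsubdigraph G) (v w : V) : R :=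
  if farcs F v w then S v w else 0.

(* [survival F n v] is the v-th entry of A^n 1, A being the weighted adjacency
   matrix of F. *)
Fixpoint survival (F : fsubdigraph G) (n : nat) (v : V) : R :=
  if n is n'.+1 then \sum_(w <- fverts F) arc_weight F v w * survival F n' w
  else 1.

Lemma row_sum_le_out (F : fsubdigraph G) (v : V) :
  ((\sum_(w <- fverts F) arc_weight F v w)%:E <= out_weight G S v)%E.
Proof.
rewrite /arc_weight -big_mkcond -big_filter.
apply: sum_weight_le_out; first by rewrite filter_uniq// fset_uniq.
by move=> w; rewrite mem_filter => /andP[vw _]; case: (farcs_sub vw).
Qed.

Hypothesis S_sub : substochastic G S.

Lemma arc_weight_ge0 (F : fsubdigraph G) (v w : V) : 0 <= arc_weight F v w.
Proof.
by rewrite /arc_weight; case: ifP => // /farcs_sub[_ _ vw]; apply/ltW/S_sub.1.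
Qed.

Lemma row_sum_le1 (F : fsubdigraph G) (v : V) :
  \sum_(w <- fverts F) arc_weight F v w <= 1.
Proof. by rewrite -lee_fin (le_trans (row_sum_le_out F v))// S_sub.2. Qed.

Lemma survival_ge0 (F : fsubdigraph G) (n : nat) (v : V) : 0 <= survival F n v.
Proof.
elim: n v => //= n IH v; apply: sumr_ge0 => w _.
by rewrite mulr_ge0// arc_weight_ge0.
Qed.

(** Row sums are at most 1, that is A 1 <= 1, and multiplication by the nonnegative A preserves this
    inequality. Bounds found at different exponents can thus be moved to a common larger one. *)
Lemma survival_noninc (F : fsubdigraph G) (m n : nat) (v : V) :
  (m <= n)%N -> survival F n v <= survival F m v.
Proof.
move=> /subnK <-; elim: (n - m)%N => // k /(le_trans _); apply.
rewrite addSn; elim: (k + m)%N v => [|l IH] v /=.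
  by under eq_bigr do rewrite mulr1; exact: row_sum_le1.
by apply: ler_sum => w _; apply: ler_wpM2l; [exact: arc_weight_ge0|exact: IH].
Qed.

Lemma survival_le1 (F : fsubdigraph G) (n : nat) (v : V) : survival F n v <= 1.
Proof. exact: (@survival_noninc F 0 n v). Qed.

(** The next survival value is a substochastic combination of those of the out-neighbours; as the
    weights may sum to less than 1, [B] must be nonnegative. *)
Lemma survivalS_le (F : fsubdigraph G) (n : nat) (v : V) (B : R) : 0 <= B ->
  (forall w, farcs F v w -> survival F n w <= B) -> survival F n.+1 v <= B.
Proof.
move=> B0 nB; rewrite (@le_trans _ _ (\sum_(w <- fverts F) arc_weight F v w * B))//.
  apply: ler_sum => w _; have := nB w; rewrite /arc_weight.
  case: ifP => [vw /(_ isT) h|]; last by rewrite !mul0r.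
  by apply: ler_wpM2l => //; apply/ltW/S_sub.1; case: (farcs_sub vw).
by rewrite -mulr_suml ler_piMl// row_sum_le1.
Qed.

(* If v -> w is not an arc of F, its weight is lost at once. *)
Lemma survivalS_le_arc (F : fsubdigraph G) (n : nat) (v w : V) : G v w ->
  survival F n.+1 v <= 1 - S v w * (1 - survival F n w).
Proof.
move=> vw; pose r := rem w (fverts F).
have wr : w \notin r by rewrite mem_rem_uniqF// fset_uniq.
have ur : uniq r by rewrite rem_uniq// fset_uniq.
(* The weight of [v -> w] uses up part of the out-weight of [v] in [G], even when [F] lacks this
   arc. *)
have rest : S v w + \sum_(u <- r) arc_weight F v u <= 1.
  rewrite /arc_weight -big_mkcond -big_filter.
  rewrite -(big_cons _ _ _ _ xpredT) -lee_fin (le_trans _ (S_sub.2 v))//.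
  apply: sum_weight_le_out.
    by rewrite /= mem_filter (negbTE wr) andbF filter_uniq.
  move=> u; rewrite inE mem_filter => /orP[/eqP->//|/andP[/farcs_sub[]//]].
have r_le : \sum_(u <- r) arc_weight F v u * survival F n u
    <= \sum_(u <- r) arc_weight F v u.
  apply: ler_sum => u _; rewrite ler_piMr ?arc_weight_ge0//.
  exact: survival_le1.
have Sw : 0 <= S v w * survival F n w.
  by rewrite mulr_ge0 ?survival_ge0// ltW// S_sub.1.
have : survival F n.+1 v <= S v w * survival F n w
    + \sum_(u <- r) arc_weight F v u * survival F n u.
  rewrite /=; have [wF|wF] := boolP (w \in fverts F); last first.
    by rewrite /r rem_id// lerDr.
  rewrite (perm_big _ (perm_to_rem wF)) big_cons lerD2r /arc_weight.
  by case: ifP => //; rewrite mul0r.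
by lra.
Qed.

(* The row vector x of moduli of an eigenvector satisfies |z| x <= x A; pair it
   with A^n 1. *)
Lemma eigenvalue_le_survival (F : fsubdigraph G) (z : R[i]) (n : nat) (B : R) :
  eigenvalue (map_mx (fun x => x%:C%C) (wadj S F)) z ->
  (forall v, survival F n v <= B) -> ComplexField.Normc.normc z ^+ n <= B.
Proof.
move=> /eigenvalueP[v vz v0] nB; set A := wadj S F in vz.
pose x i := ComplexField.Normc.normc (v 0 i).
pose u k (i : 'I_#|{: fverts F}|) := survival F k (val (enum_val i)).
have A_ge0 i j : 0 <= A i j by rewrite mxE; exact: arc_weight_ge0.
have u_ge0 k i : 0 <= u k i by exact: survival_ge0.
have x_ge0 i : 0 <= x i by rewrite /x; case: (v 0 i) => a b; exact: sqrtr_ge0.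
have nE (y : R[i]) : (ComplexField.Normc.normc y)%:C%C = `|y| by case: y.
have zx j : ComplexField.Normc.normc z * x j <= \sum_i x i * A i j.
  rewrite -ComplexField.Normc.normcM -lecR.
  have -> : z * v 0 j = \sum_i v 0 i * (A i j)%:C%C.
    have /matrixP/(_ 0 j) := vz; rewrite !mxE => <-.
    by apply: eq_bigr => i _; rewrite !mxE.
  rewrite nE (le_trans (ler_norm_sum _ _ _))// rmorph_sum/=.
  apply: ler_sum => i _; rewrite normrM rmorphM/= nE ler_wpM2l//.
  by rewrite ger0_norm// lecR.
have uS k i : u k.+1 i = \sum_j A i j * u k j.
  rewrite /u /= -(sum_enum_val F (fun w => arc_weight F _ w * survival F k w)).
  by apply: eq_bigr => j _; rewrite !mxE.
have main k : ComplexField.Normc.normc z ^+ k * \sum_i x i <= \sum_i x i * u k i.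
  elim: k => [|k IH].
    by rewrite mul1r; apply: ler_sum => i _; rewrite mulr1.
  rewrite exprS -mulrA.
  have z0 : 0 <= ComplexField.Normc.normc z.
    by case: (z) => a b; exact: sqrtr_ge0.
  apply: (le_trans (ler_wpM2l z0 IH)); rewrite mulr_sumr.
  under [leRHS]eq_bigr do rewrite uS mulr_sumr.
  rewrite exchange_big /=; apply: ler_sum => j _.
  rewrite mulrA (le_trans (ler_wpM2r (u_ge0 _ _) (zx j)))// mulr_suml.
  by apply: ler_sum => i _; rewrite mulrA.
have sx : 0 < \sum_i x i.
  rewrite lt_def sumr_ge0// andbT; apply: contra v0.
  rewrite psumr_eq0// => /allP xz; apply/eqP/rowP => i; rewrite mxE.
  by apply: ComplexField.Normc.eq0_normc; apply/eqP/xz; rewrite mem_index_enum.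
rewrite -(ler_pM2r sx) (le_trans (main n))// mulr_sumr.
by apply: ler_sum => i _; rewrite mulrC; apply: ler_wpM2r => //; exact: nB.
Qed.

Lemma perron_root_le_survival (F : fsubdigraph G) (n : nat) (B r : R) :
  (0 < n)%N -> (forall v, survival F n v <= B) -> 0 <= r -> B <= r ^+ n ->
  perron_root S F <= r.
Proof.
move=> n0 nB r0 Br; rewrite /perron_root /spectral_radius.
(* The [sup] of the empty set is 0, which [0 <= r] covers. *)
set E := [set _ | _ in _]; have [->|/set0P E0] := eqVneq E set0.
  by rewrite sup0.
apply: ge_sup => // _ [z /= zE <-].
rewrite -(ler_pXn2r n0) ?nnegrE//; last by case: (z) => a b; exact: sqrtr_ge0.
exact: (le_trans (eigenvalue_le_survival zE nB)).
Qed.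

Lemma eigenvalue_le_perron_root (F : fsubdigraph G) (z : R[i]) :
  eigenvalue (map_mx (fun x => x%:C%C) (wadj S F)) z ->
  ComplexField.Normc.normc z <= perron_root S F.
Proof.
move=> zE; apply: ub_le_sup; last by exists z.
(* A [sup] dominates the elements of a set that is bounded above; here 1 is a bound, by the survival
   estimate with exponent 1. *)
exists 1 => _ [y /= yE <-].
rewrite -[leLHS]expr1; apply: (eigenvalue_le_survival yE) => v.
exact: survival_le1.
Qed.
End Survival.

(** * Sufficiency: a spectral gap uniform in the subdigraph *)

Lemma bernoulli_le (R : realDomainType) (x : R) (n : nat) :
  0 <= x <= 1 -> 1 - n%:R * x <= (1 - x) ^+ n.
Proof.
move=> x01; elim: n => [|n IH]; first by rewrite mul0r subr0.
rewrite exprS -natr1; have n0 : 0 <= n%:R :> R by [].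
have h : 0 <= 1 - x by lra.
have := ler_wpM2l h IH.
by nra.
Qed.

Section SpectralGap.
Variables (R : realType) (V : countType) (G : rel V) (S : V -> V -> R).
Hypotheses (G_strong : strong [set: V] G) (S_sub : substochastic G S).

(** Induction along a path from [v] to the deficient vertex [v0]: the loss at [v0] is its deficit,
    and each arc put in front multiplies the loss by its weight. The path is taken in [G], so [n]
    and [e] do not depend on [F]. *)
Lemma survival_decay (v0 : V) : (out_weight G S v0 < 1)%E ->
  forall v, exists n (e : R), 0 < e /\
    forall F : fsubdigraph G, survival S F n v <= 1 - e.
Proof.
move=> def0 v.
have [e e0 e_def] : exists2 e : R, 0 < e & (out_weight G S v0 <= (1 - e)%:E)%E.
  case: (out_weight G S v0) def0 => [r| |] //.
    by rewrite lte_fin => r1; exists (1 - r); rewrite ?subr_gt0// subKr.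
  by move=> _; exists 1; rewrite // leNye.
have [p pG pv0] : exists2 p, path G v p & last v p = v0.
  have [->|vv0] := eqVneq v v0; first by exists [::].
  exact: G_strong.1.
elim: p v pG pv0 => [v _ /= -> | w p IH v /= /andP[vw /IH/[apply]]].
  exists 1%N, e; split => // F /=; under eq_bigr do rewrite mulr1.
  by rewrite -lee_fin (le_trans (row_sum_le_out S F v0)).
move=> [n [e' [e'0 nF]]]; exists n.+1, (S v w * e').
have Svw := S_sub.1 _ _ vw; split; first exact: mulr_gt0.
move=> F; apply: (le_trans (survivalS_le_arc S_sub F n vw)).
by rewrite lerD2l lerN2 ler_pM2l// lerBrDr addrC -lerBrDr.
Qed.

(** Monotonicity in the exponent allows the largest [n] and the smallest [e]. Keeping [e <= 1] makes
    [1 - e] an admissible bound in [survivalS_le]. *)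
Lemma survival_decay_seq (v0 : V) (s : seq V) : (out_weight G S v0 < 1)%E ->
  exists n (e : R), 0 < e <= 1 /\
    forall F : fsubdigraph G, {in s, forall v, survival S F n v <= 1 - e}.
Proof.
move=> def0; elim: s => [|v s [n [e [/andP[e0 e1] ns]]]].
  by exists 0%N, 1; rewrite ltr01 lexx.
have [m [d [d0 mv]]] := survival_decay def0 v.
exists (maxn m n), (Num.min d e); split.
  by rewrite lt_min d0 e0 /= ge_min e1 orbT.
move=> F w; rewrite inE => /orP[/eqP->|ws].
  rewrite (le_trans (survival_noninc S_sub F v (leq_maxl m n)))//.
  by rewrite (le_trans (mv F))// lerD2l lerN2 ge_min lexx.
rewrite (le_trans (survival_noninc S_sub F w (leq_maxr m n)))//.
by rewrite (le_trans (ns F w ws))// lerD2l lerN2 ge_min lexx orbT.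
Qed.

Lemma survival_decay_unif (v0 : V) (T : {fset V}) (L : nat) :
  (out_weight G S v0 < 1)%E -> cycle_transversal G T ->
  (forall c, dicycle G c -> (size c <= L)%N) ->
  exists n (e : R), 0 < e <= 1 /\
    forall (F : fsubdigraph G) v, survival S F n v <= 1 - e.
Proof.
move=> def0 T_trans L_bound.
have [m [e [e01 mT]]] := survival_decay_seq T def0.
exists (m + (L * #|` T|).+1)%N, e; split => // F v.
(* The hypothesis says that no path of exactly [k] arcs from [u] avoids [T]; the empty path refutes
   it for [k = 0]. *)
have walk k u : (forall p, path (remove_vertices G T) u p -> size p != k) ->
    survival S F (m + k) u <= 1 - e.
  elim: k u => [u /(_ [::] isT)//|k IH u uk].
  have inT w : w \in T -> forall l, survival S F (m + l) w <= 1 - e.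
    move=> wT l; rewrite (le_trans (survival_noninc S_sub F w (leq_addr l m)))//.
    exact: mT.
  have [/inT//|uT] := boolP (u \in T).
  rewrite addnS; apply: survivalS_le => // [|w /farcs_sub[_ _ uw]].
    by case/andP: e01 => _ e1; rewrite subr_ge0.
  have [/inT//|wT] := boolP (w \in T).
  apply: IH => p wp; apply: contra (uk (w :: p) _) => [/eqP<-//|].
  by apply/andP; split=> //; apply/and3P.
apply: walk => p /(transversal_free_path_size T_trans L_bound G_strong).
by rewrite -ltnS => /ltn_eqF ->.
Qed.

Lemma perron_root_gap (v0 : V) (T : {fset V}) (L : nat) :
  (out_weight G S v0 < 1)%E -> cycle_transversal G T ->
  (forall c, dicycle G c -> (size c <= L)%N) ->
  exists2 d : R, 0 < d & forall F : fsubdigraph G, d <= 1 - perron_root S F.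
Proof.
move=> def0 T_trans L_bound.
have [n [e [/andP[e0 e1] nF]]] := survival_decay_unif def0 T_trans L_bound.
(* By Bernoulli, 1 - e <= (1 - d)^(n+1). The exponent [n.+1] is positive, as extracting a root
   requires. *)
pose d := e / n.+1%:R.
have d0 : 0 < d by rewrite divr_gt0.
have d1 : d <= 1.
  by rewrite ler_pdivrMr// mul1r (le_trans e1)// ler1n.
exists d => // F; rewrite lerBrDr addrC -lerBrDr.
apply: (perron_root_le_survival S_sub (ltn0Sn n)) => [v||].
- exact: (le_trans (survival_noninc S_sub F v (leqnSn n)) (nF F v)).
- by rewrite subr_ge0.
have d01 : 0 <= d <= 1 by rewrite d1 ltW.
by rewrite (le_trans _ (bernoulli_le n.+1 d01))// /d mulrC divfK.
Qed.

End SpectralGap.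

(** * Finite transversals and bounded cycle lengths *)

Lemma sct_size_finite (R : realType) (V : countType) (G : rel V) :
  (sct_size R G < +oo)%E <-> exists T : {fset V}, cycle_transversal G T.
Proof.
split=> [/ereal_inf_lt[_ [T GT _] _]|[T GT]]; first by exists T.
apply: (@le_lt_trans _ _ (#|` T|%:R%:E)); last exact: ltry.
by apply: ereal_inf_lbound; exists T.
Qed.

Lemma lmax_finite (R : realType) (V : countType) (G : rel V) :
  (lmax R G < +oo)%E <-> exists L, forall c, dicycle G c -> (size c <= L)%N.
Proof.
split=> [|[L GL]]; last first.
  apply: (@le_lt_trans _ _ (L%:R%:E)); last exact: ltry.
  by apply: ge_ereal_sup => _ [c /GL cL <-]; rewrite lee_fin ler_nat.
move=> lfin; exists (Num.bound `|fine (lmax R G)|) => c cG.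
have le_l : ((size c)%:R%:E <= lmax R G)%E by apply: ereal_sup_ubound; exists c.
rewrite -(ler_nat R); case: (lmax R G) lfin le_l => //= r _.
rewrite lee_fin => /le_trans; apply; rewrite (le_trans (ler_norm r))//.
by rewrite ltW// archi_boundP.
Qed.

(** A single pair [M], [N] without such a cycle yields both conditions: [M] is a transversal, since
    a cycle avoiding it has count 0, and [N * size M] bounds the lengths, since a cycle meets each
    vertex of [M] at most once. *)
Lemma scattered_cycle (V : countType) (G : rel V) :
  ~ ((exists T : {fset V}, cycle_transversal G T) /\
     (exists L, forall c, dicycle G c -> (size c <= L)%N)) ->
  forall (M : seq V) (N : nat), exists c,
    dicycle G c /\ (N * count (mem M) c <= size c)%N.
Proof.
move=> noTL M N; apply: contrapT => noc; apply: noTL; split.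
  exists [fset x in M]%fset => c [c0 /andP[cG cu]]; apply: noc.
  exists c; split.
    split=> //; rewrite /ucycle cu andbT.
    by apply: sub_cycle cG => x y /and3P[].
  suff -> : count (mem M) c = 0%N by rewrite muln0.
  apply/eqP; rewrite -leqn0 leqNgt -has_count; apply/hasPn => x xc.
  by have /and3P[] := next_cycle cG xc; rewrite inE.
exists (N * size M)%N => c cG; rewrite leqNgt; apply/negP => Mc.
apply: noc; exists c; split => //; rewrite (leq_trans _ (ltnW Mc))// leq_mul2l.
rewrite -size_filter uniq_leq_size ?orbT//.
  by case: cG => _ /andP[_ cu]; rewrite filter_uniq.
by move=> x; rewrite mem_filter => /andP[].
Qed.

(** * Cycles as subdigraphs and their Perron roots *)

Section CycleSubdigraph.
Variables (V : countType) (G : rel V) (c : seq V).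
Hypothesis cG : dicycle G c.

Let cycle_verts_neq0 : [fset x in c]%fset != fset0.
Proof.
case: c cG => [[]//|x s _]; apply/fset0Pn; exists x.
by rewrite !inE eqxx.
Qed.

Let cycle_arcs_sub (v w : V) : (v \in c) && (w == next c v) ->
  [/\ v \in [fset x in c]%fset, w \in [fset x in c]%fset & G v w].
Proof.
move=> /andP[vc /eqP->]; rewrite !inE mem_next vc; split => //.
by case: cG => _ /andP[cyc _]; exact: next_cycle.
Qed.

(** Chords are left out, so the weighted adjacency matrix is a weighted cyclic permutation. *)
Definition cycle_subdigraph : fsubdigraph G :=
  @FSubdigraph V G [fset x in c]%fset (fun v w => (v \in c) && (w == next c v))
    cycle_verts_neq0 cycle_arcs_sub.

Lemma cycle_subdigraph_strong : fstrong cycle_subdigraph.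
Proof.
have [_ /andP[_ cu]] := cG; split=> [v w|v] /=; rewrite !inE => vc; last first.
  by exists (next c v); rewrite vc eqxx.
move=> wc vw; have [i p cp] := rot_to vc.
have : cycle (farcs cycle_subdigraph) (v :: p).
  rewrite -cp rot_cycle; apply: (@sub_in_cycle _ (mem c) (frel (next c))).
  - by move=> x y /= xc _ /eqP <-; rewrite /= xc eqxx.
  - exact/allP.
  - exact: cycle_next.
have : w \in v :: p by rewrite -cp mem_rot.
rewrite inE eq_sym (negbTE vw) /=; case/splitPr => p1 p2.
rewrite /= rcons_cat cat_path /= => /and3P[vp1 p1w _].
by exists (rcons p1 w); rewrite ?last_rcons// rcons_path vp1.
Qed.
End CycleSubdigraph.

Section CycleSpectrum.
Variables (R : realType) (V : countType) (G : rel V) (S : V -> V -> R).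
Variable c : seq V.
Hypotheses (S_sub : substochastic G S) (cG : dicycle G c).

(** The relation determines [x] recursively from the value 1 at the first vertex; the condition on
    [z] makes it consistent when the cycle closes. *)
Lemma cycle_eigenvector (K : fieldType) (a : V -> K) (z : K) : z != 0 ->
  z ^+ size c = \prod_(v <- c) a v -> exists x : V -> K,
  (exists2 v, v \in c & x v != 0) /\
  {in c, forall v, x v * a v = z * x (next c v)}.
Proof.
move=> z0 za; exists (fun v =>
  let i := index v c in (\prod_(u <- take i c) a u) / z ^+ i); split.
  case: c cG => [[]//|v s _]; exists v; first by rewrite inE eqxx.
  by rewrite /= eqxx /= big_nil divr1 oner_neq0.
have [_ /andP[_ cu]] := cG; move=> v vc /=.
rewrite next_nth vc; case: c cu vc za => // y s yu vys za.
set i := index v (y :: s).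
have i_s : (i < (size s).+1)%N by rewrite index_mem.
have step : (\prod_(u <- take i (y :: s)) a u) / z ^+ i * a v =
    z * ((\prod_(u <- take i.+1 (y :: s)) a u) / z ^+ i.+1).
  rewrite (take_nth v)// -cats1 big_cat big_seq1 /= nth_index//.
  by rewrite exprS invfM; field; rewrite z0 expf_neq0.
rewrite step; congr (_ * _); move: i_s; rewrite ltnS leq_eqVlt.
move=> /orP[/eqP i_s|i_s].
  (* At the last vertex [next] returns to [y], of index 0, and the full product divided by the full
     power of [z] is 1. *)
  rewrite nth_default ?i_s//= eqxx take_oversize//= big_nil divr1 -za.
  by rewrite divff// expf_neq0.
have -> // : index (nth y s i) (y :: s) = i.+1.
by rewrite -[nth y s i]/(nth y (y :: s) i.+1) index_uniq.
Qed.

Lemma le_perron_root_cycle (q : R) : 0 <= q ->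
  q ^+ size c <= \prod_(v <- c) S v (next c v) ->
  q <= perron_root S (cycle_subdigraph cG).
Proof.
move=> q0 qc; set F := cycle_subdigraph cG.
have [c0 /andP[cyc cu]] := cG.
have n0 : (0 < size c)%N by rewrite lt0n size_eq0; exact/eqP.
set P := \prod_(v <- c) _ in qc.
have P0 : 0 < P.
  rewrite /P big_seq; apply: prodr_gt0 => v vc.
  by apply: S_sub.1; exact: next_cycle.
(* The modulus of [z] is the geometric mean of the weights, and [z] is an eigenvalue. *)
pose z : R[i] := (size c).-root P%:C%C.
have zn : z ^+ size c = P%:C%C by rewrite rootCK.
have z0 : z != 0.
  by rewrite rootC_eq0// eq_complex /= negb_and gt_eqF.
have [|x [[v0 v0c xv0] xz]] :=
  @cycle_eigenvector _ (fun v => (S v (next c v))%:C%C) z z0.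
  by rewrite zn rmorph_prod.
have normz : q <= ComplexField.Normc.normc z.
  rewrite -(ler_pXn2r n0) ?nnegrE//; last by case: (z) => a b; exact: sqrtr_ge0.
  rewrite (le_trans qc)//.
  have -> : ComplexField.Normc.normc z ^+ size c = ComplexField.Normc.normc P%:C%C.
    rewrite -zn; elim: (size c) => [|k IH];
      first by rewrite ComplexField.Normc.normc1.
    by rewrite !exprS ComplexField.Normc.normcM IH.
  by rewrite /= expr0n /= addr0 sqrtr_sqr ler_norm.
apply: (le_trans normz); apply: (eigenvalue_le_perron_root S_sub).
apply/eigenvalueP; exists (\row_i x (val (enum_val i))).
  apply/rowP => j; rewrite !mxE; set u := val (enum_val j).
  have uc : u \in c by have := valP (enum_val j); rewrite /= inE.
  under eq_bigr do rewrite !mxE.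
  rewrite (sum_enum_val F (fun v => x v * (if farcs F v u then S v u else 0)%:C%C)).
  (* In the column of [u] only the predecessor of [u] on the cycle contributes. *)
  have prev_u : prev c u \in fverts F by rewrite /= inE mem_prev.
  rewrite (bigD1_seq _ prev_u) ?fset_uniq//= big1_seq => [|v /andP[vu _]].
    have := xz (prev c u); rewrite mem_prev next_prev// => /(_ uc) <-.
    by rewrite uc eqxx addr0.
  case: ifP => [/andP[vc /eqP uv]|]; last by rewrite mulr0.
  by move: vu; rewrite uv prev_next// eqxx.
have v0F : v0 \in fverts F by rewrite /= inE.
apply/eqP => /rowP/(_ (enum_rank [` v0F]%fset)); rewrite !mxE enum_rankK /=.
exact/eqP.
Qed.
End CycleSpectrum.

(** * Necessity: a weighting concentrated on scattered cycles *)

Lemma sum_half_exp_le1 (R : realFieldType) (s : seq nat) : uniq s ->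
  \sum_(i <- s) 2^-1 ^+ i.+1 <= 1 :> R.
Proof.
move=> us; pose n := (\max_(i <- s) i).+1.
have s_n i : i \in s -> (i < n)%N by move=> si; rewrite ltnS leq_bigmax_seq.
have -> : \sum_(i <- s) 2^-1 ^+ i.+1 =
    \sum_(0 <= i < n | i \in s) 2^-1 ^+ i.+1 :> R.
  rewrite -[RHS]big_filter; apply: perm_big.
  rewrite uniq_perm ?filter_uniq ?iota_uniq//.
  move=> i; rewrite mem_filter mem_index_iota /=.
  by case: (boolP (i \in s)) => // /s_n ->.
rewrite (@le_trans _ _ (\sum_(0 <= i < n) 2^-1 ^+ i.+1))//.
  rewrite [leLHS]big_mkcond; apply: ler_sum => i _.
  by case: ifP => // _; exact: exprn_ge0.
suff -> : \sum_(0 <= i < n) 2^-1 ^+ i.+1 = 1 - 2^-1 ^+ n :> R.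
  by rewrite gerBl exprn_ge0.
elim: n {s_n} => [|n IH]; first by rewrite big_nil expr0 subrr.
by rewrite big_nat_recr//= IH exprS; lra.
Qed.

Lemma exprn_le_eps (R : archiRealFieldType) (q e : R) : 0 <= q < 1 -> 0 < e ->
  exists n, q ^+ n <= e.
Proof.
move=> /andP[q0 q1] e0.
(* This bounds [q ^+ n] by 1 / (1 + n (1 - q)), which the Archimedean property makes small. *)
have qn n : q ^+ n * (1 + n%:R * (1 - q)) <= 1.
  elim: n => [|n IH]; first by rewrite expr0 mul0r addr0 mul1r.
  apply: le_trans IH; rewrite exprSr -mulrA ler_wpM2l ?exprn_ge0//.
  rewrite -natr1;
  have : 0 <= (n%:R + 1) * (1 - q) ^+ 2 by rewrite mulr_ge0 ?sqr_ge0.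
  lra.
pose n := Num.bound (e^-1 / (1 - q)); exists n.
have q1' : 0 < 1 - q by rewrite subr_gt0.
have n_big : e^-1 < n%:R * (1 - q).
  by rewrite -ltr_pdivrMr// archi_boundP// ltW// divr_gt0// invr_gt0.
have en : 1 <= e * (1 + n%:R * (1 - q)).
  rewrite -[leLHS](mulfV (lt0r_neq0 e0)) ler_wpM2l ?(ltW e0)//.
  by rewrite (le_trans (ltW n_big))// lerDr.
have pos : 0 < 1 + n%:R * (1 - q) by rewrite ltr_wpDr// mulr_ge0// ltW.
by rewrite -(ler_pM2r pos) (le_trans (qn n)).
Qed.

(* Even codes come from the first occurrence in f, odd codes from [pickle]. *)
Lemma exists_code (T : countType) (f : nat -> T) : exists code : T -> nat,
  injective code /\ forall k, (code (f k) <= k.*2)%N.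
Proof.
have /choice[g gP] : forall x, exists m,
    (exists2 k, m = k.*2 & f k = x /\ forall j, f j = x -> (k <= j)%N) \/
    (m = (choice.pickle x).*2.+1 /\ forall k, f k != x).
  move=> x.
  have [fx|fx] := pselect (exists k, f k == x); last first.
    exists (choice.pickle x).*2.+1; right; split=> // k.
    by apply/negP => fk; apply: fx; exists k.
  case: (ex_minnP fx) => k /eqP fk kmin; exists k.*2; left; exists k => //.
  by split=> // j /eqP; exact: kmin.
exists g; split=> [x y gxy|k].
  have [[k gk [fk _]]|[gx _]] := gP x; have [[l gl [fl _]]|[gy _]] := gP y.
  - by rewrite -fk -fl; congr f; apply: double_inj; rewrite -gk -gl.
  - by have := congr1 odd gxy; rewrite gk gy /= !odd_double.
  - by have := congr1 odd gxy; rewrite gl gx /= !odd_double.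
  apply: (pcan_inj choice.pickleK); apply: double_inj; apply: succn_inj.
  by rewrite -gx -gy.
have [[l -> [_ lmin]]|[_ /(_ k)]] := gP (f k); last by rewrite eqxx.
by rewrite leq_double lmin.
Qed.

Section ScatteredCycles.
Variables (R : realType) (V : countType) (G : rel V).
Hypothesis scattered : forall (M : seq V) (N : nat), exists c,
  dicycle G c /\ (N * count (mem M) c <= size c)%N.

(** Guaranteed weight of an arc of the k-th cycle at a vertex that no earlier cycle uses; it tends
    to 1. *)
Definition cycle_weight (k : nat) : R := 1 - k.+2%:R^-1.
Local Notation q := cycle_weight.

Lemma cycle_weight01 (k : nat) : 0 <= q k < 1.
Proof.
rewrite /cycle_weight subr_ge0 invf_le1 ?ler1n// ltrBlDr ltrDl invr_gt0 ltr0n//.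
Qed.

Lemma sparse_cycle_sequence :
  exists (C M : nat -> seq V) (N : nat -> nat),
  [/\ forall k, dicycle G (C k),
      forall k v, (v \in M k) <-> exists2 j, (j < k)%N & v \in C j,
      forall k, (N k * count (mem (M k)) (C k) <= size (C k))%N &
      forall k, q k ^+ N k <= k.+2%:R^-1 * 2^-1 ^+ k.*2.+2].
Proof.
(* The right-hand side is a lower bound for the weight of an arc of the k-th cycle at an old vertex:
   the share there is at least 1 / (k + 2) and the code at most 2k. An old vertex thus costs at most
   [N k] factors [q k]. *)
have /choice[N NP] : forall k, exists n,
    q k ^+ n <= k.+2%:R^-1 * 2^-1 ^+ k.*2.+2.
  move=> k; apply: exprn_le_eps (cycle_weight01 k) _.
  by rewrite mulr_gt0 ?exprn_gt0 ?invr_gt0.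
have /choice[D DP] : forall MN : seq V * nat, exists c,
    dicycle G c /\ (MN.2 * count (mem MN.1) c <= size c)%N.
  by move=> [M n]; exact: scattered.
pose M := fix M k := if k is k'.+1 then D (M k', N k') ++ M k' else [::].
exists (fun k => D (M k, N k)), M, N; split => //.
- by move=> k; case: (DP (M k, N k)).
- elim=> [|k IH] v; first by split=> // -[].
  rewrite /= mem_cat; split=> [/orP[vk|/IH[j jk vj]]|[j jk vj]].
  + by exists k.
  + by exists j => //; exact: ltnW.
  + move: jk; rewrite ltnS leq_eqVlt => /orP[/eqP<-|jk]; first by rewrite vj.
    by apply/orP; right; apply/IH; exists j.
- by move=> k; case: (DP (M k, N k)).
Qed.

Lemma scattered_weighting :
  exists S : V -> V -> R, truthly_substochastic G S /\
  forall k, exists2 F : fsubdigraph G,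
    fstrong F & 1 - 2 / k.+2%:R <= perron_root S F.
Proof.
have [C [M [N [CG MC NC qN]]]] := sparse_cycle_sequence.
(* [first v] is the index of the first cycle through [v], with the default 0 if there is none. *)
have /choice[first firstP] : forall v, exists m, forall k, v \in C k ->
    v \in C m /\ (m <= k)%N.
  move=> v; have [vC|vC] := pselect (exists k, v \in C k); last first.
    by exists 0%N => k vk; exfalso; apply: vC; exists k.
  by case: (ex_minnP vC) => m vm mmin; exists m => k vk; split=> //; exact: mmin.
have /choice[code codeP] : forall v, exists g : V -> nat,
    injective g /\ forall k, (g (next (C k) v) <= k.*2)%N.
  by move=> v; exact: exists_code (fun k => next (C k) v).
pose d v : R := (first v).+2%:R^-1.
(* Codes are injective, so with the exponent shifted by 2 the second terms add up to at most
   [d v / 2]; the other half of [d v] is a deficit at every vertex. *)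
pose S v w : R := (1 - d v) * (w == next (C (first v)) v)%:R
  + d v * 2^-1 ^+ (code v w).+2.
have d0 v : 0 < d v by rewrite invr_gt0.
have d1 v : d v < 1 by rewrite invf_lt1// ltr1n.
have S_gt0 v w : 0 < S v w.
  apply: ltr_wpDl; first by rewrite mulr_ge0// subr_ge0 ltW.
  by rewrite mulr_gt0// exprn_gt0// invr_gt0.
have S_out v : (out_weight G S v <= (1 - d v / 2)%:E)%E.
  apply: ge_ereal_sup => _ [A [finA _] <-].
  rewrite fsbig_finite// sumEFin lee_fin.
  set s := fset_set A; pose a := next (C (first v)) v.
  have -> : \sum_(w <- s) S v w = (1 - d v) * (\sum_(w <- s) (w == a)%:R)
      + d v * \sum_(w <- s) 2^-1 ^+ (code v w).+2.
    by rewrite big_split !mulr_sumr.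
  have h1 : \sum_(w <- s) (w == a)%:R <= 1 :> R.
    rewrite -natr_sum -[1]/(1%:R) ler_nat.
    have -> : (\sum_(w <- s) (w == a) = count_mem a s)%N.
      by rewrite -sum1_count [RHS]big_mkcond; apply: eq_bigr => w _ /=; case: eqP.
    by rewrite count_uniq_mem ?fset_uniq// leq_b1.
  have h2 : \sum_(w <- s) 2^-1 ^+ (code v w).+2 <= 2^-1 :> R.
    under eq_bigr do rewrite exprS.
    rewrite -mulr_sumr ler_piMr ?invr_ge0//.
    rewrite -(big_map (code v) xpredT (fun i => 2^-1 ^+ i.+1)).
    apply: sum_half_exp_le1; rewrite map_inj_uniq ?fset_uniq//.
    by case: (codeP v).
  have := ler_wpM2l (ltW (d0 v)) h2.
  have h3 : 0 <= 1 - d v by rewrite subr_ge0 ltW.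
  by have := ler_wpM2l h3 h1; lra.
have S_lt1 v : (out_weight G S v < 1)%E.
  by apply: (le_lt_trans (S_out v)); rewrite lte_fin gtrBl divr_gt0.
have S_sub : substochastic G S by split=> [v w _|v]; [exact: S_gt0|exact: ltW].
exists S; split.
  split=> //; have [] := CG 0%N; case: (C 0%N) => // v _ _ _.
  by exists v; exact: S_lt1.
move=> k; exists (cycle_subdigraph (CG k)); first exact: cycle_subdigraph_strong.
have /andP[q0 q1] := cycle_weight01 k.
(* The square arises because each vertex of [C k] costs one factor [q k] and the old ones together
   at most [size C_k] more. *)
apply: (@le_trans _ _ (q k ^+ 2)).
  rewrite /cycle_weight; move: (k.+2%:R^-1) => t.
  by have := sqr_ge0 t; rewrite !expr2; lra.
apply: (le_perron_root_cycle S_sub); first exact: exprn_ge0.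
(* A new vertex has [C k] as its first cycle; for an old one the choice of [N k] applies. *)
have weight_ge v : v \in C k ->
    q k * q k ^+ (N k * (v \in M k)) <= S v (next (C k) v).
  move=> vk; have [vf fk] := firstP _ _ vk.
  have [vM|vM] := boolP (v \in M k); last first.
    have {}fk : first v = k.
      apply/eqP; rewrite eqn_leq fk /= leqNgt; apply: contra vM => lt_fk.
      by apply/MC; exists (first v).
    rewrite muln0 expr0 mulr1 /S /d fk eqxx mulr1 lerDl.
    by rewrite mulr_ge0 ?invr_ge0 ?exprn_ge0 ?invr_ge0.
  rewrite muln1 (@le_trans _ _ (q k ^+ N k))//.
    by rewrite ler_piMl ?exprn_ge0// ltW.
  rewrite (le_trans (qN k))// /S.
  rewrite (@le_trans _ _ (d v * 2^-1 ^+ (code v (next (C k) v)).+2))//.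
    apply: ler_pM; rewrite ?invr_ge0 ?exprn_ge0//.
      by rewrite lef_pV2 ?posrE// ler_nat !ltnS.
    rewrite ler_wiXn2l ?invr_ge0 ?invf_le1 ?ler1n// !ltnS.
    by case: (codeP v).
  by rewrite lerDr mulr_ge0// subr_ge0 ltW.
have prod_eq (s : seq V) : \prod_(v <- s) (q k * q k ^+ (N k * (v \in M k)))
    = q k ^+ (size s + N k * count (mem (M k)) s).
  elim: s => [|v s IH]; first by rewrite big_nil muln0.
  by rewrite big_cons IH -exprS -exprD /=; congr (_ ^+ _); lia.
apply: (@le_trans _ _ (\prod_(v <- C k) (q k * q k ^+ (N k * (v \in M k))))).
  rewrite prod_eq -exprM ler_wiXn2l ?(ltW q1)// mul2n -addnn leq_add2l.
  exact: NC.
rewrite big_seq [leRHS]big_seq; apply: ler_prod => v vk.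
by rewrite weight_ge// andbT mulr_ge0 ?exprn_ge0.
Qed.
End ScatteredCycles.

(** * The two implications *)

(** The infimum over strong subdigraphs is at least that over all finite ones, so this weaker
    hypothesis serves both equivalences. *)
Lemma strong_perron_gap_finite (R : realType) (V : countType) (G : rel V) :
  (forall S : V -> V -> R, truthly_substochastic G S ->
    (0 < ereal_inf [set (1 - perron_root S F)%:E
                   | F in [set F : fsubdigraph G | fstrong F]])%E) ->
  (sct_size R G < +oo)%E /\ (lmax R G < +oo)%E.
Proof.
move=> gap; rewrite sct_size_finite lmax_finite; apply: contrapT.
move=> /scattered_cycle /(scattered_weighting R)[S [/gap + S_F]].
apply/negP; rewrite -leNgt; apply/lee_addgt0Pr => e e0.
rewrite add0e; pose k := Num.bound (2 / e); have [F sF kF] := S_F k.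
apply: ge_ereal_inf; exists (1 - perron_root S F)%:E; first by exists F.
rewrite lee_fin; suff : 2 / k.+2%:R <= e by move: (2 / _) kF => t; lra.
rewrite ler_pdivrMr// mulrC -ler_pdivrMr// ltW//.
rewrite (lt_trans (archi_boundP _))// ?divr_ge0// ?ltW//.
by rewrite ltr_nat ltnS.
Qed.

(** The gap is uniform over all finite subdigraphs, hence holds on any family [P], in particular on
    the two in question. *)
Lemma finite_perron_gap (R : realType) (V : countType) (G : rel V)
    (S : V -> V -> R) (P : set (fsubdigraph G)) : strong [set: V] G ->
  (sct_size R G < +oo)%E /\ (lmax R G < +oo)%E -> truthly_substochastic G S ->
  (0 < ereal_inf [set (1 - perron_root S F)%:E | F in P])%E.
Proof.
move=> G_strong; rewrite sct_size_finite lmax_finite => -[[T GT] [L GL]].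
move=> [S_sub [v0 def0]].
have [d d0 dF] := perron_root_gap G_strong S_sub def0 GT GL.
apply: (@lt_le_trans _ _ d%:E); first by rewrite lte_fin.
by apply: le_ereal_inf_tmp => _ [F _ <-]; rewrite lee_fin.
Qed.

Unset Implicit Arguments.
Set Strict Implicit.

Theorem proposition4 (R : realType) (V : countType) (G : rel V) :
  strong [set: V] G ->
  ((forall S : V -> V -> R, truthly_substochastic G S ->
      (0 < ereal_inf [set (1 - perron_root S F)%:E
                     | F in [set: fsubdigraph G]])%E)
   <-> (sct_size R G < +oo)%E /\ (lmax R G < +oo)%E)
  /\
  ((forall S : V -> V -> R, truthly_substochastic G S ->
      (0 < ereal_inf [set (1 - perron_root S F)%:E
                     | F in [set F : fsubdigraph G | fstrong F]])%E)
   <-> (sct_size R G < +oo)%E /\ (lmax R G < +oo)%E).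
Proof.
move=> G_strong; split; split.
- move=> gap; apply: strong_perron_gap_finite => S /gap /lt_le_trans; apply.
  by apply: ereal_inf_le_tmp => _ [F _ <-]; exists F.
- by move=> fin S; exact: finite_perron_gap.
- exact: strong_perron_gap_finite.
- by move=> fin S; exact: finite_perron_gap.
Qed.
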